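(* Let $V$ be a distribution supported on $[0,\infty)$, let $\tau$ be a nonnegative integer-valued random variable with $p_k=P(\tau=k)>0$ for all $k\ge0$, and let $V^{*\tau}=\sum_{k=0}^\infty p_kV^{*k}$. For each constant $0<\varepsilon<1$, assume that there is an integer $n_0=n_0(V,\tau,\varepsilon)\ge1$ such that $$\sum_{k=n_0+1}^{\infty}p_{k}\overline{V^{*(k-1)}}(x)\le\varepsilon\,\overline{V^{*\tau}}(x)\quad\text{for all } x\ge0 .$$ If $V^{*\tau}\in\mathcal{OS}$, then $V^{*n}\in\mathcal{OS}$ for all $n\ge n_0$. Moreover, let $\gamma\ge0$ and suppose that for all $k\ge1$, $$\liminf_{x\to\infty}\overline{V^{*k}}(x-t)/\overline{V^{*k}}(x)\ge e^{\gamma t}\quad\text{for all } t>0 .$$ If (in addition to $V^{*\tau}\in\mathcal{OS}$) $V^{*\tau}\in\mathcal L(\gamma)$, then for all $n\ge n_0$, $V^{*n}\in\mathcal L(\gamma)$, and thus $V^{*n}\in\mathcal L(\gamma)\cap\mathcal{OS}$. Here, if $n_0\ge2$ and if there exists an integer $1\le l_0\le n_0-1$ such that $V^{*l_0}\in\mathcal{OS}$, then $V^{*n}\in\mathcal L(\gamma)\cap\mathcal{OS}$ for all $n\ge l_0$. In particular, if $V\in\mathcal{OS}$, that is, $l_0=1$, then $V\in\mathcal L(\gamma)\,(\cap\,\mathcal{OS})$.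
   Context: All limits are as $x\to\infty$. $\overline V=1-V$ is the tail of $V$; $V^{*k}$ is the $k$-fold convolution of $V$ with itself, $V^{*0}$ being the distribution degenerate at $0$. $f\sim g$ means $f/g\to1$. For $\gamma\ge0$, $V\in\mathcal L(\gamma)$ if $\overline V(x)>0$ for all $x$ and $\overline V(x-t)\sim e^{\gamma t}\,\overline V(x)$ for every fixed $t>0$ (if $\gamma>0$ and $V$ is lattice, $x$ and $t$ are restricted to values of the lattice span). $V\in\mathcal{OS}$ if $\limsup\overline{V^{*2}}(x)/\overline V(x)<\infty$.
   Formalization: The claims ''for all n ≥ n_0'' are proved for every n_0 valid for an ε at most some ε_0(V,τ) in (0,1), since for arbitrary ε in (0,1) they fail (Poisson τ, V not in OS with V^{*2} in OS, n_0=1); the l_0 and ''in particular'' claims hold for all ε. *)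

(* Defs.v *)
From HB Require Import structures.
From mathcomp Require Import all_boot all_order all_algebra.
From mathcomp Require Import all_classical all_reals all_analysis measurable_realfun.
Import Order.TTheory GRing.Theory Num.Theory.
Import numFieldNormedType.Exports.

Set Implicit Arguments.
Unset Strict Implicit.
Unset Printing Implicit Defensive.

Local Open Scope classical_set_scope.
Local Open Scope ring_scope.

Section convolution.
Context {R : realType}.
Implicit Types V W : probability (measurableTypeR R) R.

Definition sum_coords (z : measurableTypeR R * measurableTypeR R) :
  measurableTypeR R := z.1 + z.2.

Let measurable_sum_coords : measurable_fun setT sum_coords.
Proof. exact: measurable_funD. Qed.

HB.instance Definition _ :=
  isMeasurableFun.Build _ _ _ _ sum_coords measurable_sum_coords.

Definition conv V W : probability (measurableTypeR R) R :=
  distribution (V \x W)%E sum_coords.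

Fixpoint convn V (k : nat) : probability (measurableTypeR R) R :=
  if k is k'.+1 then conv V (convn V k') else \d_(0 : measurableTypeR R).

Definition tail V (x : R) : R := fine (V `]x, +oo[%classic).

End convolution.

Section random_convolution.
Local Open Scope ereal_scope.
Context {R : realType} (V : probability (measurableTypeR R) R).
Context {d} {Omega : measurableType d} {P : probability Omega R}.
Variable tau : {RV P >-> nat}.

Definition prob_eq (k : nat) : R := fine (P (tau @^-1` [set k])).

Definition randconv (A : set (measurableTypeR R)) : \bar R :=
  \sum_(0 <= k <oo) (prob_eq k)%:E * convn V k A.

Let prob_eq_ge0 k : (0 <= prob_eq k)%R.
Proof. by rewrite fine_ge0. Qed.

Let randconv_mseries :
  randconv = mseries (fun k => mscale (NngNum (prob_eq_ge0 k)) (convn V k)) 0.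
Proof. by []. Qed.

Let randconv0 : randconv set0 = 0.
Proof. by rewrite randconv_mseries measure0. Qed.

Let randconv_ge0 A : 0 <= randconv A.
Proof. by rewrite randconv_mseries measure_ge0. Qed.

Let randconv_sigma_additive : semi_sigma_additive randconv.
Proof. by rewrite randconv_mseries; exact: measure_semi_sigma_additive. Qed.

HB.instance Definition _ := isMeasure.Build _ _ _ randconv
  randconv0 randconv_ge0 randconv_sigma_additive.

Let randconv_setT : randconv setT = 1.
Proof.
rewrite /randconv.
have mt k : measurable (tau @^-1` [set k]).
  by rewrite -[X in measurable X]setTI; exact: measurable_funP.
rewrite (eq_eseriesr (g := fun k => P (tau @^-1` [set k]))); last first.
  move=> k _; rewrite probability_setT mule1 fineK//.
  exact: fin_num_measure.
rewrite -(probability_setT P).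
have -> : [set: Omega] = \bigcup_k (tau @^-1` [set k]).
  by apply/seteqP; split => // w _; exists (tau w).
rewrite measure_bigcup//=; first by apply: eq_eseriesl => k; rewrite in_setT.
apply/trivIsetP => i j _ _ ij; apply/seteqP; split => // w [] /= ti tj.
by rewrite -ti -tj eqxx in ij.
Qed.

HB.instance Definition _ := Measure_isProbability.Build _ _ _ randconv
  randconv_setT.

End random_convolution.

Section tail_classes.
Context {R : realType}.
Implicit Types V : probability (measurableTypeR R) R.

(* The ratio of tails is meaningful only if the tail never vanishes; since
   [x / 0 = 0], positivity has to be required explicitly. *)
Definition OS V : Prop :=
  (forall x : R, 0 < tail V x) /\
  (limf_esup (fun x : R => (tail (conv V V) x / tail V x)%:E) (pinfty_nbhs R) < +oo)%E.

(* Lattice distributions are allowed a shift [a]; the span is the largest step. *)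
Definition carried_by_lattice V (h : R) : Prop :=
  exists a : R, V [set a + h * m%:~R | m in [set: int]] = 1%E.

Definition lattice_span V (h : R) : Prop :=
  [/\ 0 < h, carried_by_lattice V h &
      forall h' : R, 0 < h' -> carried_by_lattice V h' -> h' <= h].

(* The values to which [x] and [t] are restricted: the multiples of the span if
   [gamma > 0] and [V] is lattice, all the reals otherwise. *)
Definition admissible (gamma : R) V : set R :=
  [set x | forall h, 0 < gamma -> lattice_span V h ->
           exists m : int, x = h * m%:~R].

Definition at_infinity (gamma : R) V : set_system R :=
  within (admissible gamma V) (pinfty_nbhs R).

Definition tail_equiv (F : set_system R) (f g : R -> R) : Prop :=
  (f x / g x) @[x --> F] --> (1 : R).

Definition in_L (gamma : R) V : Prop :=
  (forall x : R, 0 < tail V x) /\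
  (forall t : R, 0 < t -> admissible gamma V t ->
     tail_equiv (at_infinity gamma V)
       (fun x => tail V (x - t)) (fun x => expR (gamma * t) * tail V x)).

(* One-sided version of [in_L], under the same convention for lattice [V]. *)
Definition liminf_cond (gamma : R) V : Prop :=
  forall t : R, 0 < t -> admissible gamma V t ->
    ((expR (gamma * t))%:E <=
     limf_einf (fun x : R => (tail V (x - t) / tail V x)%:E)
       (at_infinity gamma V))%E.

Definition tail_series_cond V d (Omega : measurableType d)
    (P : probability Omega R) (tau : {RV P >-> nat}) (eps : R) (n0 : nat) :
    Prop :=
  (1 <= n0)%N /\
  forall x : R, 0 <= x ->
    (\sum_(n0.+1 <= k <oo) (prob_eq tau k * tail (convn V k.-1) x)%:E
       <= (eps * tail (randconv V tau) x)%:E)%E.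

End tail_classes.

(* Main.v *)
From Pilot Require Import Defs.
From mathcomp Require Import all_boot all_order all_algebra.
From mathcomp Require Import all_classical all_reals all_analysis.
From mathcomp Require Import measurable_realfun lra ring.
Import Order.TTheory GRing.Theory Num.Theory.
Import numFieldNormedType.Exports.
Import Pilot.Defs.
Local Open Scope classical_set_scope.
Local Open Scope ring_scope.
Set Implicit Arguments.
Unset Strict Implicit.
Unset Printing Implicit Defensive.

(** Write [T k] for the tail of [V^{*k}], [W] for the random convolution and
    [p k] for the probability that [tau = k].

    The tails [T k] increase with [k], because [V] lives on the nonnegative
    half-line, and each of them is at most a multiple of the tail of [W]. The
    theorem follows from a converse domination, tail of [W] at most [K * T n],
    for one convolution power. This makes [V^{*n}] a member of OS, since its
    square [V^{*(n + n)}] is again a summand of [W] ([OS_convn_of_dominates]).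
    It also transfers L(gamma) from [W] to [V^{*n}] ([in_L_convn]): under the
    lower limit condition every summand grows by a factor at least
    [expR (gamma * t)] when [x] becomes [x - t], while the sum grows by exactly
    that factor, so that no summand forming a positive proportion of the sum can
    grow by more. Only finitely many summands matter there, because the
    remainder of the series is uniformly small with respect to the tail of [W]
    ([partial_tail_near]).

    The domination comes from conditioning the terms of rank greater than [n0]
    on one of their summands: the hypothesis on the shifted series bounds their
    sum by [eps] times the tail of the convolution of [V] and [W], plus a
    multiple of the tail of [V] ([remainder_le]). As [W] is in OS, the former
    tail is at most [C] times that of [W]; if [eps * C <= 1 / 2], half of the
    tail of [W] is absorbed and the rest is at most [T n0]
    ([randconv_tail_le_convn]). If moreover some [V^{*l0}] is in OS, then
    [T (j * l0)] is at most a multiple of [T l0] for every [j]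
    ([tail_convn_mul_le]), and the domination descends from [n0] to [l0].

    Lattice distributions require one more argument, since the points at which
    L(gamma) is tested depend on the span of the distribution. The powers of [V]
    have the same span as [V] ([carried_convn]). The random convolution gives
    mass to the origin, so that it may have a smaller span, or none, when the
    lattice of [V] is shifted; in any case its admissible points include those
    of [V] ([admissible_convn_sub]). *)

(** * Tails of convolutions *)

Section tails.
Context {R : realType}.
Implicit Types G H K : probability (measurableTypeR R) R.

Lemma tailE G x : (tail G x)%:E = G `]x, +oo[%classic.
Proof. by rewrite /tail fineK// fin_num_measure. Qed.

Lemma tail_ge0 G x : 0 <= tail G x.
Proof. by rewrite -lee_fin tailE measure_ge0. Qed.

Lemma tail_le1 G x : tail G x <= 1.
Proof. by rewrite -lee_fin tailE probability_le1. Qed.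

Lemma tail_nonincr G x y : x <= y -> tail G y <= tail G x.
Proof.
move=> xy; rewrite -lee_fin !tailE le_measure ?inE//.
by apply: subset_itvr; rewrite bnd_simp.
Qed.

Lemma measurable_tail G : measurable_fun setT (tail G : measurableTypeR R -> R).
Proof.
by apply: nonincreasing_measurable => // x y; exact: tail_nonincr.
Qed.

Lemma measurable_tail_sub G (x : R) :
  measurable_fun setT (fun y : measurableTypeR R => (tail G (x - y))%:E).
Proof.
apply/measurable_EFinP; apply: measurableT_comp; first exact: measurable_tail.
by apply: measurable_funB => //; exact: measurable_cst.
Qed.

Lemma integral_conv G H (f : measurableTypeR R -> \bar R) :
  measurable_fun setT f -> (forall x, 0 <= f x)%E ->
  (\int[conv G H]_z f z = \int[G]_x \int[H]_y f (x + y)%R)%E.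
Proof.
move=> mf f0; rewrite ge0_integral_distribution//.
rewrite fubini_tonelli1//; last by move=> z; exact: f0.
by apply: measurableT_comp => //; exact: measurable_funD.
Qed.

Lemma integral_conv_swap G H (f : measurableTypeR R -> \bar R) :
  measurable_fun setT f -> (forall x, 0 <= f x)%E ->
  (\int[conv G H]_z f z = \int[H]_y \int[G]_x f (x + y)%R)%E.
Proof.
move=> mf f0; rewrite ge0_integral_distribution//.
rewrite fubini_tonelli2//; last by move=> z; exact: f0.
by apply: measurableT_comp => //; exact: measurable_funD.
Qed.

Lemma tail_indic G x :
  (tail G x)%:E = (\int[G]_z (\1_(`]x, +oo[%classic : set R) z)%:E)%E.
Proof. by rewrite tailE integral_indic// setIT. Qed.

Lemma indic_gt_add (x y z : R) :
  \1_(`]x, +oo[%classic : set R) (y + z) = \1_(`]x - y, +oo[%classic : set R) z :> R.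
Proof.
rewrite !indicE; congr (_%:R); congr nat_of_bool.
by apply/idP/idP; rewrite !inE/= !in_itv/= !andbT ltrBlDl.
Qed.

Lemma tail_conv G H x :
  (tail (conv G H) x)%:E = (\int[G]_y (tail H (x - y))%:E)%E.
Proof.
rewrite tail_indic integral_conv//; last exact/measurable_EFinP.
by apply: eq_integral => y _; rewrite tail_indic; apply: eq_integral => z _;
  rewrite indic_gt_add.
Qed.

Lemma tail_convC G H x : tail (conv G H) x = tail (conv H G) x.
Proof.
apply: EFin_inj; rewrite tail_conv tail_indic integral_conv_swap//;
  last exact/measurable_EFinP.
apply: eq_integral => y _; rewrite tail_indic; apply: eq_integral => z _.
by rewrite (addrC z) indic_gt_add.
Qed.

Lemma tail_conv_le G H K (c : R) x : 0 <= c ->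
  (forall y, tail H y <= c * tail K y) ->
  tail (conv G H) x <= c * tail (conv G K) x.
Proof.
move=> c0 HK; rewrite -lee_fin EFinM !tail_conv -ge0_integralZl//; last 2 first.
- exact: measurable_tail_sub.
- by move=> y _; rewrite lee_fin tail_ge0.
apply: ge0_le_integral => //.
- by move=> y _; rewrite lee_fin tail_ge0.
- exact: measurable_tail_sub.
- by apply: measurable_funeM; exact: measurable_tail_sub.
- by move=> y _; rewrite -EFinM lee_fin.
Qed.

Lemma tail_eq_conv G H K : (forall y, tail H y = tail K y) ->
  forall x, tail (conv G H) x = tail (conv G K) x.
Proof.
move=> HK x; apply: EFin_inj; rewrite !tail_conv.
by apply: eq_integral => y _; rewrite HK.
Qed.

Lemma tail_convA G H K x :
  tail (conv (conv G H) K) x = tail (conv G (conv H K)) x.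
Proof.
apply: EFin_inj; rewrite tail_conv integral_conv.
- rewrite tail_conv; apply: eq_integral => y _; rewrite tail_conv.
  by apply: eq_integral => z _; rewrite opprD addrA.
- exact: measurable_tail_sub.
- by move=> z; rewrite lee_fin tail_ge0.
Qed.

Lemma convn1E G (A : set (measurableTypeR R)) : measurable A -> convn G 1 A = G A.
Proof.
move=> mA.
have := @integral_conv G (\d_(0 : measurableTypeR R)) (fun z => (\1_A z)%:E).
rewrite integral_indic// setIT => -> //; last exact/measurable_EFinP/measurable_indic.
transitivity (\int[G]_x (\1_A x)%:E)%E; last by rewrite integral_indic// setIT.
apply: eq_integral => x _; rewrite integral_dirac//= ?diracT ?mul1e ?addr0//.
apply/measurable_EFinP; apply: measurableT_comp; first exact: measurable_indic.
by apply: measurable_funD => //; exact: measurable_cst.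
Qed.

Lemma tail_convn1 G x : tail (convn G 1) x = tail G x.
Proof. by apply: EFin_inj; rewrite !tailE convn1E. Qed.

Lemma tail_convn0 G (x : R) : 0 <= x -> tail (convn G 0) x = 0.
Proof.
move=> x0; apply: EFin_inj; rewrite tailE/= diracE memNset//=.
by rewrite in_itv/= andbT; apply/negP; rewrite -leNgt.
Qed.

Lemma tail_convn_add G a b x :
  tail (conv (convn G a) (convn G b)) x = tail (convn G (a + b)) x.
Proof.
elim: a x => [|a IH] x.
  apply: EFin_inj; rewrite tail_conv integral_dirac//=.
    by rewrite diracT mul1e subr0.
  exact: measurable_tail_sub.
by rewrite addSn/= tail_convA; exact: tail_eq_conv.
Qed.

(** Adding an independent nonnegative term can only enlarge the value. *)
Lemma tail_convn_homo G : G `[0, +oo[%classic = 1%E ->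
  forall m n : nat, (m <= n)%N -> forall x, tail (convn G m) x <= tail (convn G n) x.
Proof.
move=> G0 m n mn x; rewrite -(subnK mn).
elim: (n - m)%N => [|k IH]; first by rewrite add0n.
rewrite addSn; apply: (le_trans IH) => /=.
set T := convn G _; rewrite -lee_fin tail_conv.
have mT A : measurable_fun A (fun y : measurableTypeR R => (tail T (x - y))%:E).
  by apply: measurable_funTS; exact: measurable_tail_sub.
rewrite -[leLHS]mule1 -G0 -integral_cst//.
apply: (@le_trans _ _ (\int[G]_(y in `[0%R, +oo[%classic) (tail T (x - y))%:E)%E).
  apply: ge0_le_integral => //.
  - by move=> y _; rewrite lee_fin tail_ge0.
  - by move=> y /=; rewrite in_itv/= andbT => y0; rewrite lee_fin tail_nonincr// gerBl.
by apply: ge0_subset_integral => // y _; rewrite lee_fin tail_ge0.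
Qed.

(** The upper limit bounds the ratio beyond some point; before that point, the
    tail of [G] is bounded away from zero, hence the bound is global. *)
Lemma OS_bound G : OS G ->
  exists2 C : R, 0 < C & forall x, tail (conv G G) x <= C * tail G x.
Proof.
move=> [G0]; rewrite limf_esupE => /ereal_inf_lt[_ [A [M [_ MA]] <-]] supA.
have M1A : A (M + 1) by apply: MA; rewrite ltrDl.
have fA x : A x -> ((tail (conv G G) x / tail G x)%:E <=
    ereal_sup [set (tail (conv G G) x / tail G x)%:E | x in A])%E.
  by move=> Ax; apply: ereal_sup_ubound; exists x.
move: supA fA; case: ereal_sup => [C _ fA|//|_ /(_ _ M1A)//].
have C0 : 0 <= C.
  have := fA _ M1A; rewrite lee_fin; apply: le_trans.
  by rewrite divr_ge0// tail_ge0.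
exists (C + (tail G (M + 1))^-1); first by rewrite ltr_wpDl// invr_gt0.
move=> x; rewrite mulrDl; have [xM|Mx] := leP x (M + 1).
  rewrite ler_wpDl ?mulr_ge0// ?tail_ge0//.
  rewrite (le_trans (tail_le1 _ _))// mulrC ler_pdivlMr// mul1r.
  exact: tail_nonincr.
rewrite ler_wpDr ?mulr_ge0 ?invr_ge0 ?tail_ge0//.
rewrite -ler_pdivrMr// -lee_fin; apply: fA; apply: MA.
by apply: lt_trans Mx; rewrite ltrDl.
Qed.

Lemma OS_intro G (C : R) : (forall x, 0 < tail G x) ->
  (forall x, tail (conv G G) x <= C * tail G x) -> OS G.
Proof.
move=> G0 GC; split => //.
rewrite limf_esupE; apply: (@le_lt_trans _ _ C%:E); last exact: ltry.
apply: ge_ereal_inf.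
exists (ereal_sup [set (tail (conv G G) x / tail G x)%:E | x in [set: R]]).
  by exists [set: R] => //; exact: filterT.
by apply: ge_ereal_sup => y [x _ <-]; rewrite lee_fin ler_pdivrMr.
Qed.

(** By induction, replacing at each step a square of [G^{*l}] by a multiple of
    [G^{*l}] inside the convolution with the remaining factors. *)
Lemma tail_convn_mul_le G (l : nat) : G `[0, +oo[%classic = 1%E -> OS (convn G l) ->
  forall j, exists2 C : R, 0 < C &
    forall x, tail (convn G (j * l)) x <= C * tail (convn G l) x.
Proof.
move=> G0 /OS_bound[C C0 hC]; elim=> [|j [D D0 hD]].
  by exists 1 => // x; rewrite mul1r tail_convn_homo.
exists (D * C); first exact: mulr_gt0.
move=> x; rewrite mulSn -tail_convn_add.
apply: le_trans (@tail_conv_le (convn G l) _ (convn G l) D x (ltW D0) hD) _.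
by rewrite -mulrA ler_pM2l.
Qed.

End tails.

(** * Lattices *)

Section lattices.
Context {R : realType}.
Implicit Types G H : probability (measurableTypeR R) R.

Definition lattice (a h : R) : set R := [set a + h * m%:~R | m in [set: int]].

Lemma latticeP (a h x : R) : lattice a h x <-> exists m : int, x = a + h * m%:~R.
Proof. by split=> [[m _ <-]|[m ->]]; exists m. Qed.

Lemma measurable_lattice (a h : R) :
  measurable (lattice a h : set (measurableTypeR R)).
Proof.
apply: countable_measurable => [t|]; first exact: measurable_set1.
exact: card_le_trans (card_image_le _ _) (countableP _).
Qed.
Hint Resolve measurable_lattice : core.

Lemma carriedE G (h : R) :
  carried_by_lattice G h = (exists a, G (lattice a h) = 1%E).
Proof. by []. Qed.

Lemma prob_eq1 G (A B : set (measurableTypeR R)) : measurable A -> measurable B ->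
  A `<=` B -> G A = 1%E -> G B = 1%E.
Proof.
move=> mA mB AB GA; apply/eqP; rewrite eq_le probability_le1//= -GA.
by rewrite le_measure ?inE.
Qed.

Lemma prob_setC0 G (A : set (measurableTypeR R)) : measurable A ->
  G A = 1%E <-> G (~` A) = 0%E.
Proof.
move=> mA; rewrite probability_setC//; split => [->|/eqP]; first by rewrite subee.
by rewrite sube_eq ?fin_num_measure// add0e => /eqP ->.
Qed.

Lemma prob_eq1I G (A B : set (measurableTypeR R)) : measurable A -> measurable B ->
  G A = 1%E -> G B = 1%E -> G (A `&` B) = 1%E.
Proof.
move=> mA mB /(prob_setC0 _ mA) GA /(prob_setC0 _ mB) GB.
apply/prob_setC0; first exact: measurableI.
apply/eqP; rewrite setCI -measure_le0.
have := measureU2 G (measurableC mA) (measurableC mB).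
by rewrite [X in (_ <= X + _)%E -> _]GA [X in (_ <= _ + X)%E -> _]GB add0e.
Qed.

Lemma carried_conv G H (h : R) : carried_by_lattice G h ->
  carried_by_lattice H h -> carried_by_lattice (conv G H) h.
Proof.
rewrite !carriedE => -[a Ga] [b Hb]; exists (a + b).
have ms : measurable_fun setT (@sum_coords R) by exact: measurable_funP.
apply/eqP; rewrite eq_le probability_le1//=.
rewrite /conv/= /distribution/= /pushforward.
have <- : (G \x H)%E (lattice a h `*` lattice b h) = 1%E.
  by rewrite product_measure1E// -[RHS]mule1; congr (_ * _)%E; [exact: Ga|exact: Hb].
apply: le_measure; rewrite ?inE//.
- exact: measurableX.
- by rewrite -[X in measurable X]setTI; apply: ms.
- move=> [_ _] [/= [m _ <-] [n _ <-]]; apply/latticeP; exists (m + n).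
  by rewrite /sum_coords/= intrD; ring.
Qed.

(** If [X + Y] lies almost surely in a lattice and [Y] is independent of [X],
    then for almost every value [y] of [Y] the variable [X] lies in the lattice
    shifted by [y]; one such [y] is enough. *)
Lemma carried_convl G H (h : R) :
  carried_by_lattice (conv G H) h -> carried_by_lattice G h.
Proof.
rewrite !carriedE => -[a GH].
have ms : measurable_fun setT (@sum_coords R) by exact: measurable_funP.
pose f (z : measurableTypeR R) := (\1_(~` lattice a h) z)%:E : \bar R.
have f0 z : (0 <= f z)%E by rewrite lee_fin.
have mf : measurable_fun setT f.
  by apply/measurable_EFinP; apply: measurable_indic; exact: measurableC.
have mF : measurable_fun setT (fun y => \int[G]_x f (x + y)%R)%E.
  apply: (measurable_fun_fubini_tonelli_G (fun z => f (sum_coords z))) => //.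
  exact: measurableT_comp.
have : (\int[H]_y `|\int[G]_x f (x + y)%R|)%E = 0%E.
  under eq_integral do rewrite gee0_abs ?integral_ge0//.
  rewrite -integral_conv_swap// integral_indic//; last exact: measurableC.
  by rewrite setIT; apply/prob_setC0.
move=> /(ae_eq_integral_abs H measurableT mF)[N [mN HN0 subN]].
have [y Ny] : exists y, ~ N y.
  apply/existsNP => allN; have NT : N = setT by apply/seteqP; split.
  by have := probability_setT H; rewrite -NT HN0 => /eqP; rewrite eq_sym onee_eq0.
have /(_ I) := contrapT (fun nf => Ny (subN y nf)).
under eq_integral => x _.
  rewrite (_ : f _ = (\1_(~` lattice (a - y) h) x)%:E); last first.
    rewrite /f !indicE; congr (_%:R%:E); congr nat_of_bool.
    apply/idP/idP; rewrite !inE => nL /latticeP[m zE]; apply: nL; apply/latticeP;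
      exists m; first by rewrite zE; ring.
    by rewrite -(addrK y x) zE; ring.
  over.
rewrite integral_indic ?setIT//; last exact: measurableC.
by move=> GL0; exists (a - y); apply/prob_setC0.
Qed.

Lemma carried_convn G (h : R) (n : nat) : (0 < n)%N ->
  carried_by_lattice (convn G n) h <-> carried_by_lattice G h.
Proof.
case: n => // n _; split; first exact: carried_convl.
move=> Gh; elim: n.+1 => [|k IH]; last exact: carried_conv.
exists 0; rewrite -/(lattice 0 h)/= diracE mem_set//.
by apply/latticeP; exists 0; rewrite mulr0 addr0.
Qed.

Lemma admissible_eq G H :
  (forall h, carried_by_lattice G h <-> carried_by_lattice H h) ->
  forall gamma, admissible gamma G = admissible gamma H.
Proof.
move=> GH gamma.
have GHs h : lattice_span G h <-> lattice_span H h.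
  by split=> -[h0 /GH hG maxh]; split => // h' h'0 /GH; exact: maxh.
by apply/seteqP; split => x + h g0 /GHs => /(_ h g0).
Qed.

Lemma atom_in_lattice G (a h x : R) :
  G (lattice a h) = 1%E -> (0 < G [set x])%E -> lattice a h x.
Proof.
move=> GL Gx; apply: contrapT => nLx.
have : (G [set x] <= G (~` lattice a h))%E.
  apply: le_measure; rewrite ?inE.
  - exact: measurable_set1.
  - exact: measurableC.
  - by move=> y ->.
by rewrite ((prob_setC0 _ _).1 GL)// leNgt Gx.
Qed.

(** A lattice is countable, so that a set of positive mass contains one of its
    points with positive mass. *)
Lemma exists_atom G (a h u : R) : G (lattice a h) = 1%E -> 0 < tail G u ->
  exists2 x : R, u < x & (0 < G [set x])%E.
Proof.
move=> GL; rewrite -lte_fin tailE => Gu; apply: contrapT => noatom.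
have atom0 x : u < x -> G [set x] = 0%E.
  move=> ux; apply/eqP; rewrite -measure_le0 leNgt; apply/negP => Gx.
  by apply: noatom; exists x.
have : G.-negligible `]u, +oo[%classic.
  (* Countable unions are indexed by [nat], hence the detour by [unpickle]. *)
  pose F (n : nat) : set (measurableTypeR R) :=
    if unpickle n is Some m then [set a + h * (m : int)%:~R] `&` `]u, +oo[%classic
    else set0.
  have sub : `]u, +oo[%classic `<=` ~` lattice a h `|` \bigcup_n F n.
    move=> x ux; have [/latticeP[m xE]|] := pselect (lattice a h x); last by left.
    by right; exists (pickle m) => //; rewrite /F pickleK.
  apply: (@negligibleS _ (measurableTypeR R) R G _ _ sub); apply: negligibleU.
    by exists (~` lattice a h); split => //; [exact: measurableC|exact/prob_setC0].
  apply: negligible_bigcup => n; rewrite /F; case: unpickle => [m|]; last exact: negligible_set0.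
  exists ([set a + h * m%:~R] `&` `]u, +oo[%classic); split => //.
    by apply: measurableI => //; exact: measurable_set1.
  have [um|mu] := ltP u (a + h * m%:~R).
    apply/eqP; rewrite -measure_le0 -(atom0 _ um); apply: le_measure; rewrite ?inE.
    - by apply: measurableI => //; exact: measurable_set1.
    - exact: measurable_set1.
    - exact: subIsetl.
  rewrite (_ : _ `&` _ = set0) ?measure0//.
  by apply/seteqP; split => // x [->]/=; rewrite in_itv/= andbT ltNge mu.
by move=> /negligibleP => /(_ (measurable_itv _)) Gu0; rewrite Gu0 ltxx in Gu.
Qed.

(** A distribution carried by a lattice and having unbounded support has two
    atoms [x0 < x1], and every carrying lattice has a step dividing [x1 - x0].
    The multiples [h * q] of the given step that carry [G] are thus bounded, and
    the greatest of them is the span. *)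
Lemma exists_lattice_span G (h : R) : (forall x, 0 < tail G x) -> 0 < h ->
  carried_by_lattice G h ->
  exists2 q : nat, (0 < q)%N & lattice_span G (h * q%:R).
Proof.
move=> G0 h0 Gh; have := Gh; rewrite carriedE => -[a GL].
have [x0 _ Gx0] := exists_atom GL (G0 0).
have [x1 x01 Gx1] := exists_atom GL (G0 x0).
have carried_le h' : 0 < h' -> carried_by_lattice G h' ->
    exists2 m : nat, (0 < m)%N & x1 - x0 = h' * m%:R.
  rewrite carriedE => h'0 [b GL'].
  have /latticeP[m0 x0E] := atom_in_lattice GL' Gx0.
  have /latticeP[m1 x1E] := atom_in_lattice GL' Gx1.
  have d0 : x1 - x0 = h' * (m1 - m0)%:~R by rewrite x0E x1E intrB; ring.
  have m01 : 0 < m1 - m0.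
    by move: x01; rewrite -subr_gt0 d0 pmulr_rgt0// ltr0z.
  exists `|m1 - m0|%N; first by rewrite absz_gt0 gt_eqF.
  by rewrite d0 pmulrn gez0_abs// ltW.
pose P q := (0 < q)%N && `[< carried_by_lattice G (h * q%:R) >].
have [N hN] : exists N : nat, forall q, P q -> (q <= N)%N.
  have [N _ dN] := carried_le _ h0 Gh.
  exists N => q /andP[q0 /asboolP Gq].
  have [] := carried_le _ _ Gq; first by rewrite mulr_gt0// ltr0n.
  move=> m m0; rewrite dN -mulrA -natrM => /(mulfI (lt0r_neq0 h0))/eqP.
  by rewrite eqr_nat => /eqP ->; rewrite leq_pmulr.
have P1 : exists q, P q.
  by exists 1%N; apply/andP; split => //; apply/asboolP; rewrite mulr1.
case: (ex_maxnP P1 hN) => q /andP[q0 /asboolP Gq] qmax.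
exists q => //; have hq0 : 0 < h * q%:R by rewrite mulr_gt0// ltr0n.
split => // h' h'0 Gh'.
(* The two lattices through [x0] meet in a lattice of step [h * q * r]; it still
   carries [G], so that maximality of [q] forces [r = 1]. *)
pose D r := (0 < r)%N && `[< exists m : int, h * q%:R * r%:R = h' * m%:~R >].
have D0 : exists r, D r.
  have [m m0 dE] := carried_le _ hq0 Gq.
  have [m' _ dE'] := carried_le _ h'0 Gh'.
  by exists m; rewrite /D m0/=; apply/asboolP; exists m'; rewrite -dE dE'.
case: (ex_minnP D0) => r /andP[r0 /asboolP[c rE]] rmin.
have r_dvd (m m' : int) : h * q%:R * m%:~R = h' * m'%:~R -> (r %| m)%Z.
  move=> mE; apply/dvdz_mod0P; apply: contrapT => /eqP nz.
  have rz : (r : int) != 0 by rewrite gt_eqF// ltz_nat.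
  have mod0 : 0 <= (m %% r)%Z by rewrite modz_ge0.
  have : D `|(m %% r)%Z|%N.
    rewrite /D absz_gt0 nz/=; apply/asboolP; exists (m' - c * (m %/ r)%Z).
    have -> : `|(m %% r)%Z|%N%:R = m%:~R - (m %/ r)%Z%:~R * r%:R :> R.
      by rewrite pmulrn gez0_abs// /modz intrB intrM -pmulrn.
    by rewrite mulrBr mE mulrCA rE intrB intrM; ring.
  move=> /rmin; rewrite leqNgt -ltz_nat gez0_abs// => /negP; apply.
  by rewrite ltz_pmod.
have Gqr : carried_by_lattice G (h * (q * r)%:R).
  move: Gq Gh'; rewrite !carriedE => -[b GLb] [b' GLb']; exists x0.
  have GI : G (lattice b (h * q%:R) `&` lattice b' h') = 1%E.
    exact: prob_eq1I.
  apply: (prob_eq1 _ _ _ GI) => //; first exact: measurableI.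
  move=> x [/latticeP[m xE] /latticeP[m' xE']].
  have /latticeP[m0 x0E] := atom_in_lattice GLb Gx0.
  have /latticeP[m0' x0E'] := atom_in_lattice GLb' Gx0.
  have := r_dvd (m - m0) (m' - m0').
  rewrite !intrB !mulrBr => /(_ _)/dvdzP[|k mk].
    by apply: (addrI b); lra.
  apply/latticeP; exists k; rewrite xE x0E natrM -(subrK m0 m) mk intrD intrM.
  by rewrite -pmulrn; ring.
have r1 : r = 1%N.
  have : (q * r <= q)%N by apply: qmax; rewrite /P muln_gt0 q0 r0/=; apply/asboolP.
  by rewrite -[leqRHS]muln1 leq_pmul2l// => r1; apply/eqP; rewrite eqn_leq r1.
have c0 : 0 < c by rewrite -(ltr0z R) -(pmulr_rgt0 _ h'0) -rE r1 mulr1.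
have -> : h * q%:R = h' * c%:~R by rewrite -rE r1 mulr1.
by rewrite -[leLHS]mulr1 ler_pM2l// ler1z -gtz0_ge1.
Qed.

Lemma admissible_convn G (gamma : R) (n k : nat) : (0 < n)%N -> (0 < k)%N ->
  admissible gamma (convn G n) = admissible gamma (convn G k).
Proof.
by move=> n0 k0; apply: admissible_eq => h; rewrite !carried_convn.
Qed.

End lattices.

(** * Distributions that agree on measurable sets *)

Section measure_ext.
Context {R : realType} (G H : probability (measurableTypeR R) R).
Hypothesis GH : forall A : set (measurableTypeR R), measurable A -> G A = H A.

Lemma tail_ext x : tail G x = tail H x.
Proof. by apply: EFin_inj; rewrite !tailE GH. Qed.

Lemma OS_ext : OS G -> OS H.
Proof.
move=> [G0 OSG]; split=> [x|]; first by rewrite -tail_ext.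
rewrite (_ : (fun x => _) = (fun x => (tail (conv G G) x / tail G x)%:E))//.
apply/funext => x; rewrite tail_ext; congr (_ / _)%:E; apply: EFin_inj.
rewrite !tail_conv (eq_measure_integral G); last by move=> A mA _; exact/esym/GH.
by apply: eq_integral => y _; rewrite tail_ext.
Qed.

Lemma in_L_ext (gamma : R) : in_L gamma G -> in_L gamma H.
Proof.
have adm : admissible gamma G = admissible gamma H.
  apply: admissible_eq => h; split=> -[a]; exists a.
    by rewrite -GH//; exact: measurable_lattice.
  by rewrite GH//; exact: measurable_lattice.
have tGH : tail G = tail H by apply/funext => x; exact: tail_ext.
by rewrite /in_L /at_infinity adm tGH.
Qed.

End measure_ext.

(** * Asymptotic conditions as inequalities near infinity *)

Section near_infinity.
Context {R : realType}.
Implicit Type G : probability (measurableTypeR R) R.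

(** The restriction to admissible points is kept as a premise, rather than in
    the filter, because distributions with different admissible sets have to be
    compared at the same points. *)
Lemma liminf_cond_near G (gamma t delta : R) :
  liminf_cond gamma G -> 0 < t -> admissible gamma G t -> 0 < delta ->
  \forall x \near +oo, admissible gamma G x ->
    (expR (gamma * t) - delta) * tail G x <= tail G (x - t).
Proof.
move=> liG t0 admt delta0.
have : ((expR (gamma * t) - delta)%:E < (expR (gamma * t))%:E)%E.
  by rewrite lte_fin gtrBl.
move=> /lt_le_trans/(_ (liG t t0 admt)); rewrite limf_einfE => /ereal_sup_gt.
move=> [_ [A nA <-]] Alt.
have nA' : \forall x \near +oo, admissible gamma G x -> A x by exact: nA.
apply: (filterS _ nA') => x /[apply] Ax.
have : ((expR (gamma * t) - delta)%:E <= (tail G (x - t) / tail G x)%:E)%E.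
  by apply: le_trans (ltW Alt) _; apply: ereal_inf_lbound; exists x.
rewrite lee_fin; have := tail_ge0 G x; rewrite le_eqVlt => /predU1P[<- _|Gx].
  by rewrite mulr0 tail_ge0.
by rewrite ler_pdivlMr.
Qed.

Lemma in_L_near G (gamma t delta : R) :
  in_L gamma G -> 0 < t -> admissible gamma G t -> 0 < delta ->
  \forall x \near +oo, admissible gamma G x ->
    tail G (x - t) <= (expR (gamma * t) + delta) * tail G x.
Proof.
move=> [G0 LG] t0 admt delta0; have E0 := expR_gt0 (gamma * t).
have := LG t t0 admt; rewrite /tail_equiv => /cvgrPdist_le.
move=> /(_ _ (divr_gt0 delta0 E0)) near_ratio.
have near_ratio' : \forall x \near +oo, admissible gamma G x ->
    `|1 - tail G (x - t) / (expR (gamma * t) * tail G x)| <= delta / expR (gamma * t).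
  by exact: near_ratio.
apply: (filterS _ near_ratio') => x /[apply].
rewrite distrC ler_norml => /andP[_]; rewrite lerBlDr ler_pdivrMr; last by rewrite mulr_gt0.
move=> /le_trans; apply; rewrite mulrA mulrDl mul1r divfK ?gt_eqF//.
by rewrite addrC.
Qed.

End near_infinity.

(** * Remainders of series *)

Lemma nneseries_remainder {R : realType} (a : nat -> R) (S : R) (m : nat) :
  (forall k, 0 <= a k) -> (\sum_(0 <= k <oo) (a k)%:E = S%:E)%E ->
  ((S - \sum_(0 <= k < m) a k)%:E = \sum_(m <= k <oo) (a k)%:E)%E.
Proof.
move=> a0 aS; have := @nneseries_split R (fun k => (a k)%:E) 0 m _.
rewrite aS add0n sumEFin EFinB => -> //.
  by rewrite addeAC subee// add0e.
by move=> k _; rewrite lee_fin.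
Qed.

(** * Comparison with the random convolution *)

(** The arithmetic of [in_L_convn]: [w], [a], [b] are the values at [x] of the
    whole, of the summand of interest and of the other summands kept, and [w'],
    [a'], [b'] are the values at [x - t]. *)
Lemma summand_growth_bound {R : realFieldType} (E d c w w' a a' b b' : R) :
  0 <= d -> d <= E -> 0 <= w -> 0 <= a ->
  w - (a + b) <= d * w -> a' + b' <= w' -> (E - d) * b <= b' -> w' <= (E + d) * w ->
  d * (2 + E) * w <= c * E * a -> a' <= (E + c * E) * a.
Proof.
move=> d0 dE w0 a0 hb hw' hb' hw hd.
have step : (E - d) * (w - a - d * w) <= (E - d) * b by apply: ler_wpM2l; lra.
have dw : 0 <= d * d * w by rewrite !mulr_ge0.
have da : 0 <= d * a by rewrite mulr_ge0.
lra.
Qed.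

Section random_sum.
Context {R : realType} (V : probability (measurableTypeR R) R)
  {d : measure_display} {Omega : measurableType d} {P : probability Omega R}
  (tau : {RV P >-> nat}).
Hypothesis tau_pos : forall k : nat, 0 < prob_eq tau k.

Local Notation p := (prob_eq tau).
Local Notation T k := (tail (convn V k)).
Local Notation W := (randconv V tau : probability (measurableTypeR R) R).

Lemma sum_prob_eq : (\sum_(0 <= k <oo) (p k)%:E = 1%:E)%E.
Proof.
rewrite -(probability_setT W); apply: eq_eseriesr => k _.
by rewrite probability_setT mule1.
Qed.

Lemma tail_randconv x :
  (\sum_(0 <= k <oo) (p k * T k x)%:E = (tail W x)%:E)%E.
Proof.
by rewrite tailE; apply: eq_eseriesr => k _; rewrite -tailE EFinM.
Qed.

Lemma partial_tail_le m x : \sum_(0 <= k < m) p k * T k x <= tail W x.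
Proof.
rewrite -lee_fin -tail_randconv -sumEFin; apply: nneseries_lim_ge => k _ _.
by rewrite lee_fin mulr_ge0 ?tail_ge0// ltW.
Qed.

Lemma tail_randconv_ge k x : p k * T k x <= tail W x.
Proof.
apply: le_trans (partial_tail_le k.+1 x).
by rewrite big_nat_recr//= lerDr sumr_ge0// => j _; rewrite mulr_ge0 ?tail_ge0// ltW.
Qed.

(** As [V] is one of the terms of the random convolution, its tail is at most a
    multiple of that of the latter, whose square is controlled by OS. *)
Lemma tail_conv_randconv_bound : OS W ->
  exists2 C : R, 0 < C & forall x, tail (conv V W) x <= C * tail W x.
Proof.
move=> /OS_bound[C C0 WC]; exists ((p 1)^-1 * C); first by rewrite mulr_gt0// invr_gt0.
move=> x; rewrite tail_convC -mulrA.
apply: le_trans (@tail_conv_le _ W V W (p 1)^-1 x _ _) _.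
- by rewrite invr_ge0 ltW.
- by move=> y; rewrite ler_pdivlMl// -tail_convn1 tail_randconv_ge.
- by rewrite ler_pM2l// invr_gt0.
Qed.

(** Splitting off one summand turns the remainder of the series at
    [n0] into an integral, against [V], of the series that the hypothesis
    bounds at [x - y]; the values [y > x] of that summand contribute at most
    [P (tau > n0)] times the tail of [V]. *)
Lemma remainder_le (eps : R) (n0 : nat) : 0 <= eps -> tail_series_cond V tau eps n0 ->
  forall x, tail W x - \sum_(0 <= k < n0.+1) p k * T k x <=
    eps * tail (conv V W) x + (1 - \sum_(0 <= k < n0.+1) p k) * tail V x.
Proof.
move=> eps0 [n0_gt0 cond] x.
have p0 k : 0 <= p k by exact: ltW.
have pT0 k j y : 0 <= p k * T j y by rewrite mulr_ge0// tail_ge0.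
set Q := 1 - _.
have QE : (Q%:E = \sum_(n0.+1 <= k <oo) (p k)%:E)%E.
  by apply: nneseries_remainder => //; exact: sum_prob_eq.
rewrite -lee_fin (nneseries_remainder _ _ (tail_randconv x))//.
rewrite -nneseries_addn; last by move=> k; rewrite lee_fin; exact: pT0.
have pTm k : measurable_fun setT (fun y : measurableTypeR R =>
    (p (k + n0.+1)%N)%:E * (T (k + n0)%N (x - y))%:E)%E.
  by apply: measurable_funeM; exact: measurable_tail_sub.
have -> : (\sum_(0 <= k <oo) (p (k + n0.+1)%N * T (k + n0.+1)%N x)%:E =
    \int[V]_y (\sum_(0 <= k <oo)
       ((p (k + n0.+1)%N)%:E * (T (k + n0)%N (x - y))%:E)))%E.
  rewrite integral_nneseries//.
    apply: eq_eseriesr => k _.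
    have -> : T (k + n0.+1) x = tail (conv V (convn V (k + n0))) x by rewrite addnS.
    rewrite EFinM tail_conv ge0_integralZl ?lee_fin//; first exact: measurable_tail_sub.
    by move=> y _; rewrite lee_fin tail_ge0.
  by move=> k y _; rewrite -EFinM lee_fin; exact: pT0.
pose neg (y : measurableTypeR R) : R := \1_(`]x, +oo[%classic : set R) y.
have mneg : measurable_fun setT neg by exact: measurable_indic.
have -> : ((eps * tail (conv V W) x + Q * tail V x)%:E =
    \int[V]_y ((eps * tail W (x - y) + Q * neg y)%:E))%E.
  under eq_integral do rewrite EFinD !EFinM.
  have Q0 : (0 <= Q%:E)%E by rewrite QE nneseries_ge0// => k _ _; rewrite lee_fin.
  rewrite ge0_integralD//; first last.
  - by apply: measurable_funeM; apply/measurable_EFinP.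
  - by move=> y _; rewrite mule_ge0// lee_fin.
  - by apply: measurable_funeM; exact: measurable_tail_sub.
  - by move=> y _; rewrite -EFinM lee_fin mulr_ge0// tail_ge0.
  rewrite !ge0_integralZl//.
  - by rewrite -tail_conv -tail_indic EFinD !EFinM.
  - by apply/measurable_EFinP.
  - by move=> y _; rewrite lee_fin.
  - exact: measurable_tail_sub.
  - by move=> y _; rewrite lee_fin tail_ge0.
apply: ge0_le_integral => //.
- by move=> y _; apply: nneseries_ge0 => k _ _; rewrite -EFinM lee_fin.
- apply: ge0_emeasurable_sum.
    by move=> k y _ _; rewrite -EFinM lee_fin.
  by move=> k _; exact: pTm.
- apply/measurable_EFinP; apply: measurable_funD; apply: measurable_funM => //.
  by apply/measurable_EFinP; exact: measurable_tail_sub.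
move=> y _; under eq_eseriesr do rewrite -EFinM.
rewrite /neg indicE; have [xy|yx] := ltP x y.
  rewrite mem_set/= ?in_itv/= ?xy// mulr1.
  apply: (@le_trans _ _ Q%:E).
    rewrite QE -nneseries_addn; last by move=> k; rewrite lee_fin.
    apply: lee_nneseries => [k _ _|k _]; first by rewrite lee_fin.
    by rewrite lee_fin ler_piMr// tail_le1.
  by rewrite lee_fin lerDr mulr_ge0// tail_ge0.
rewrite memNset/= ?in_itv/= ?andbT; last by apply/negP; rewrite -leNgt.
rewrite mulr0 addr0; apply: le_trans (cond (x - y) _); last by rewrite subr_ge0.
rewrite -(@nneseries_addn _ _ n0.+1); last by move=> k; rewrite lee_fin; exact: pT0.
by apply: lee_nneseries => [k _ _|k _]; rewrite ?lee_fin// addnS.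
Qed.

Lemma tail_series_cond_mono (eps : R) (n m : nat) : (n <= m)%N ->
  tail_series_cond V tau eps n -> tail_series_cond V tau eps m.
Proof.
move=> nm [n0 cond]; split; first exact: leq_trans nm.
have pT0 k x : (0 <= (prob_eq tau k * tail (convn V k.-1) x)%:E)%E.
  by rewrite lee_fin mulr_ge0 ?tail_ge0// ltW.
move=> x x0; apply: le_trans (cond x x0).
rewrite (@nneseries_split _ _ n.+1 (m - n)) ?addSn ?subnKC//.
by rewrite leeDr// sume_ge0.
Qed.

Lemma sum_prob_eq_near1 (delta : R) : 0 < delta ->
  exists N : nat, forall m, (N <= m)%N -> 1 - \sum_(0 <= k < m) p k <= delta.
Proof.
move=> delta0.
have p0 k : 0 <= p k by exact: ltW.
have : (\sum_(0 <= k < m) (p k)%:E @[m --> \oo] --> 1%:E)%E.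
  by rewrite -sum_prob_eq; apply: is_cvg_nneseries => k _ _; rewrite lee_fin.
under eq_fun do rewrite sumEFin.
move=> /fine_cvgP[_] /cvgrPdist_le /(_ _ delta0)[N _ hN]; exists N => m Nm.
exact: le_trans (ler_norm _) (hN m Nm).
Qed.

(** Both terms of [remainder_le] are small multiples of the tail of the random
    convolution: the first because [eps] may be chosen small and the random
    convolution is in OS, the second because [P (tau >= m)] tends to 0. *)
Lemma partial_tail_near (delta : R) : OS W -> 0 < delta ->
    (forall eps : R, 0 < eps < 1 -> exists n0 : nat, tail_series_cond V tau eps n0) ->
  exists N : nat, forall m, (N <= m)%N -> forall x,
    tail W x - \sum_(0 <= k < m) p k * T k x <= delta * tail W x.
Proof.
move=> /tail_conv_randconv_bound[C C0 VW] delta0 n0_ex.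
(* One half of [delta] is spent on each of the two terms of [remainder_le]. *)
pose eps := Num.min (1 / 2) (delta / 2 / C).
have eps0 : 0 < eps by rewrite lt_min !divr_gt0.
have epsC : eps * C <= delta / 2 by rewrite -ler_pdivlMr// ge_min lexx orbT.
have eps1 : eps < 1 by rewrite gt_min ltr_pdivrMr//; apply/orP; left; lra.
have [|n0 cond] := n0_ex eps; first by rewrite eps0.
have [|N hN] := @sum_prob_eq_near1 (p 1 * (delta / 2)).
  by rewrite mulr_gt0// divr_gt0.
exists (maxn n0.+1 N) => -[|m]; first by rewrite geq_max.
rewrite geq_max ltnS => /andP[n0m Nm] x.
have := remainder_le (ltW eps0) (tail_series_cond_mono n0m cond) x.
move=> /le_trans; apply; rewrite [X in _ <= X * _]splitr [leRHS]mulrDl; apply: lerD.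
  apply: (@le_trans _ _ (eps * (C * tail W x))); first by rewrite ler_pM2l.
  by rewrite mulrA ler_wpM2r// tail_ge0.
apply: (@le_trans _ _ (p 1 * (delta / 2) * tail V x)).
  by rewrite ler_wpM2r ?tail_ge0// hN.
rewrite -tail_convn1 -mulrA mulrCA; apply: ler_wpM2l; last exact: tail_randconv_ge.
by rewrite divr_ge0// ltW.
Qed.

(** The [n0]-fold convolution already dominates: all [V^{*k}] with [k <= n0]
    have smaller tails, and for small [eps] the remainder absorbs at most half
    of the tail of the random convolution. *)
Lemma randconv_tail_le_convn (C eps : R) (n0 : nat) :
  V `[0, +oo[%classic = 1%E ->
  (forall x, tail (conv V W) x <= C * tail W x) ->
  0 <= eps -> eps * C <= 1 / 2 -> tail_series_cond V tau eps n0 ->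
  forall x, tail W x <= 2 * T n0 x.
Proof.
move=> V_supp VW eps0 epsC cond x; have [n0_gt0 _] := cond.
have := remainder_le eps0 cond x.
set Sp := \sum_(0 <= k < n0.+1) p k.
have Sp1 : 0 <= 1 - Sp.
  rewrite -lee_fin (nneseries_remainder _ _ sum_prob_eq)//; last by move=> k; exact: ltW.
  by apply: nneseries_ge0 => k _ _; rewrite lee_fin ltW.
have VWx : eps * tail (conv V W) x <= tail W x / 2.
  apply: (@le_trans _ _ (eps * (C * tail W x))); first by rewrite ler_wpM2l.
  by rewrite mulrA mulrC ler_wpM2l ?tail_ge0// -[leRHS]div1r.
have VT : (1 - Sp) * tail V x <= (1 - Sp) * T n0 x.
  by rewrite ler_wpM2l// -tail_convn1; exact: tail_convn_homo.
have ST : \sum_(0 <= k < n0.+1) p k * T k x <= Sp * T n0 x.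
  rewrite mulr_suml !big_nat; apply: ler_sum => k /andP[_ kn].
  by apply: ler_wpM2l; [exact: ltW|exact: tail_convn_homo].
nra.
Qed.

Lemma convn_tail_gt0 (n : nat) (K : R) : OS W ->
  (forall x, tail W x <= K * T n x) -> forall x, 0 < T n x.
Proof.
move=> [W0 _] WK x; rewrite lt_neqAle tail_ge0 andbT eq_sym; apply/eqP => Tx.
by have := lt_le_trans (W0 x) (WK x); rewrite Tx mulr0 ltxx.
Qed.

(** A convolution power whose tail dominates that of the random convolution
    also dominates its own square, since the latter is one of the summands. *)
Lemma OS_convn_of_dominates (n : nat) (K : R) : OS W ->
  (forall x, tail W x <= K * T n x) -> OS (convn V n).
Proof.
move=> W_OS WK; apply: (@OS_intro _ _ ((p (n + n))^-1 * K)).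
  exact: convn_tail_gt0 W_OS WK.
move=> x; rewrite tail_convn_add -mulrA ler_pdivlMl//.
exact: le_trans (tail_randconv_ge _ _) (WK x).
Qed.

Lemma carried_randconv (h : R) : carried_by_lattice W h -> carried_by_lattice V h.
Proof.
move=> [a]; rewrite -/(lattice a h) => WL.
apply/(@carried_convn _ _ _ 1%N) => //; exists a; rewrite -/(lattice a h).
have mL : measurable (lattice a h : set (measurableTypeR R)) by exact: measurable_lattice.
apply/prob_setC0 => //; move/prob_setC0 : WL => /(_ mL) WL0.
have t0 j : (0 <= (prob_eq tau j)%:E * convn V j (~` lattice a h))%E.
  by rewrite mule_ge0// lee_fin ltW.
have : ((p 1)%:E * convn V 1 (~` lattice a h) <= 0)%E.
  rewrite -WL0; apply: le_trans (nneseries_lim_ge 2 _); last by move=> j _ _; exact: t0.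
  by rewrite big_nat_recr//= leeDr// sume_ge0.
by rewrite pmule_rle0 ?lte_fin// measure_le0 => /eqP.
Qed.

(** A lattice carrying the random convolution carries [V], but not conversely,
    as the lattice of [V] may be shifted: the span of [V] is then a multiple of
    that of the random convolution, or the latter is not lattice at all. *)
Lemma admissible_convn_sub (gamma : R) (n : nat) : (0 < n)%N ->
  (forall x, 0 < T n x) -> admissible gamma (convn V n) `<=` admissible gamma W.
Proof.
move=> n0 Tn0 x admx h g0 [h0 /carried_randconv Vh _].
have [q _ qspan] := exists_lattice_span Tn0 h0 ((carried_convn _ _ n0).2 Vh).
have [m ->] := admx _ g0 qspan.
by exists (q%:Z * m); rewrite intrM -mulrA -pmulrn.
Qed.

(** The tail of [V^{*n}] is obtained from that of the random convolution by
    removing the other summands. Each of these grows by a factor at least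
    [expR (gamma * t)] when [x] is moved to [x - t], whereas the whole sum grows by
    exactly that factor; since [V^{*n}] is a nonnegligible part of the whole,
    it cannot grow by more. *)
Lemma in_L_convn (gamma : R) (n : nat) (K : R) : (0 < n)%N -> OS W ->
  (forall eps : R, 0 < eps < 1 -> exists n0 : nat, tail_series_cond V tau eps n0) ->
  0 < K -> (forall x, tail W x <= K * T n x) ->
  (forall k : nat, (1 <= k)%N -> liminf_cond gamma (convn V k)) ->
  in_L gamma W -> in_L gamma (convn V n).
Proof.
move=> n_gt0 W_OS n0_ex K0 WK liV LW.
have Tn0 := convn_tail_gt0 W_OS WK; split => // t t0 admt.
have admW := admissible_convn_sub n_gt0 Tn0.
have FF : Filter (at_infinity gamma (convn V n)) by exact: within_filter.
rewrite /tail_equiv; apply/cvgrPdist_le => e e0.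
have E0 := expR_gt0 (gamma * t); set E := expR (gamma * t) in E0 *.
(* The error accumulated below is at most [delta * (2 + E) * tail W x]. *)
pose delta := Num.min E (e * E * p n / ((2 + E) * K)).
have delta0 : 0 < delta by rewrite lt_min E0/= divr_gt0 ?mulr_gt0 ?addr_gt0.
have deltaE : delta <= E by rewrite ge_min lexx.
have deltaK : delta * ((2 + E) * K) <= e * E * p n.
  by rewrite -ler_pdivlMr ?mulr_gt0 ?addr_gt0// ge_min lexx orbT.
have [N hN] := partial_tail_near W_OS delta0 n0_ex.
pose m := maxn N n.+1.
have nm : (n < m)%N by rewrite /m leq_maxr.
have near_k (k : 'I_m) : \forall x \near +oo, admissible gamma (convn V n) x ->
    (E - delta) * T k x <= T k (x - t).
  have [k0|k_gt0] := posnP k.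
    near=> x => _; rewrite k0 tail_convn0 ?mulr0 ?tail_ge0//.
  rewrite (admissible_convn V gamma n_gt0 k_gt0); apply: liminf_cond_near => //.
    exact: liV.
  by rewrite -(admissible_convn V gamma n_gt0 k_gt0).
have near_all : \forall x \near +oo, forall k : 'I_m,
    admissible gamma (convn V n) x -> (E - delta) * T k x <= T k (x - t).
  exact: filter_forall.
have near_W := in_L_near LW t0 (admW _ _ admt) delta0.
have near_n := liminf_cond_near (liV n n_gt0) t0 admt (mulr_gt0 e0 E0).
suff : \forall x \near +oo, admissible gamma (convn V n) x ->
    `|1 - T n (x - t) / (E * T n x)| <= e by [].
apply: filterS3 near_all near_W near_n => x hall hW hn admx.
have {}hall k := hall k admx.
have {}hW := hW (admW _ _ admx).
have {}hn : (E - e * E) * T n x <= T n (x - t) := hn admx.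
have Tx := Tn0 x.
have pn0 := tau_pos n.
have upper : p n * T n (x - t) <= (E + e * E) * (p n * T n x).
  have := partial_tail_le m (x - t).
  have := hN m (leq_maxl _ _) x.
  have split_n y : \sum_(0 <= k < m) p k * T k y =
      p n * T n y + \sum_(k < m | k != Ordinal nm) p k * T k y.
    by rewrite big_mkord (bigD1 (Ordinal nm)).
  rewrite !split_n => hS hS'.
  have SS' : (E - delta) * \sum_(k < m | k != Ordinal nm) p k * T k x <=
      \sum_(k < m | k != Ordinal nm) p k * T k (x - t).
    rewrite mulr_sumr; apply: ler_sum => k _.
    by rewrite mulrCA ler_wpM2l// ltW.
  have hW' : tail W (x - t) <= (E + delta) * tail W x := hW.
  apply: (summand_growth_bound (ltW delta0) deltaE (tail_ge0 _ _) _ hS hS' SS' hW').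
    by rewrite mulr_ge0// ltW.
  rewrite mulrA; apply: (@le_trans _ _ (delta * ((2 + E) * K) * T n x)).
    by rewrite -!mulrA ler_pM2l// ler_pM2l ?addr_gt0.
  by rewrite ler_pM2r.
rewrite mulrCA ler_pM2l// in upper.
have ET : 0 < E * T n x by rewrite mulr_gt0.
rewrite distrC ler_norml; apply/andP; split.
  rewrite lerBrDr ler_pdivlMr//; apply: le_trans hn.
  by rewrite [leLHS]mulrA [X in X * _ <= _]mulrDl mul1r mulNr addrC.
rewrite lerBlDr ler_pdivrMr//; apply: (le_trans upper).
by rewrite [leRHS]mulrA [X in _ <= X * _]mulrDl mul1r addrC.
Unshelve. all: by end_near.
Qed.

End random_sum.

(** * The theorem *)

Theorem theorem2p1 (R : realType) (V : probability (measurableTypeR R) R)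
    (d : measure_display) (Omega : measurableType d) (P : probability Omega R)
    (tau : {RV P >-> nat})
    (V_supp : V `[0, +oo[%classic = 1%E)
    (tau_pos : forall k : nat, 0 < prob_eq tau k)
    (n0_ex : forall eps : R, 0 < eps < 1 ->
       exists n0 : nat, tail_series_cond V tau eps n0)
    (W_OS : OS (randconv V tau)) :
  exists eps0 : R, 0 < eps0 < 1 /\
  forall (eps : R) (n0 : nat), 0 < eps < 1 -> tail_series_cond V tau eps n0 ->
    (eps <= eps0 -> forall n : nat, (n0 <= n)%N -> OS (convn V n)) /\
    (forall gamma : R, 0 <= gamma ->
       (forall k : nat, (1 <= k)%N -> liminf_cond gamma (convn V k)) ->
       in_L gamma (randconv V tau) ->
       [/\ eps <= eps0 -> forall n : nat, (n0 <= n)%N ->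
             in_L gamma (convn V n) /\ OS (convn V n),
           (2 <= n0)%N -> forall l0 : nat, (1 <= l0 <= n0.-1)%N ->
             OS (convn V l0) ->
             forall n : nat, (l0 <= n)%N ->
             in_L gamma (convn V n) /\ OS (convn V n)
         & OS V -> in_L gamma V /\ OS V]).
Proof.
have [C C0 VW] := tail_conv_randconv_bound tau_pos W_OS.
pose eps0 := Num.min (1 / 2) (1 / 2 / C) : R.
have eps0_gt0 : 0 < eps0 by rewrite lt_min !divr_gt0.
have eps0C : eps0 * C <= 1 / 2 by rewrite -ler_pdivlMr// ge_min lexx orbT.
have eps0_lt1 : eps0 < 1 by rewrite gt_min ltr_pdivrMr//; apply/orP; left; lra.
have homo := tail_convn_homo V_supp.
have dom eps n0 : 0 < eps <= eps0 -> tail_series_cond V tau eps n0 ->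
    forall n, (n0 <= n)%N -> forall x, tail (randconv V tau) x <= 2 * tail (convn V n) x.
  move=> /andP[e0 ee0] cond n n0n x.
  apply: le_trans (randconv_tail_le_convn tau_pos V_supp VW (ltW e0) _ cond x) _.
    by apply: le_trans eps0C; rewrite ler_pM2r.
  by rewrite ler_pM2l// homo.
have OSn := OS_convn_of_dominates tau_pos W_OS.
(* The rank [n1] at which domination starts is chosen for [eps0] and not for
   the given [eps], which may be larger; it is then lowered to [l0]. *)
have main gamma : (forall k : nat, (1 <= k)%N -> liminf_cond gamma (convn V k)) ->
    in_L gamma (randconv V tau) ->
    forall l0, (0 < l0)%N -> OS (convn V l0) -> forall n, (l0 <= n)%N ->
    in_L gamma (convn V n) /\ OS (convn V n).
  move=> liV LW l0 l0_gt0 OSl n l0n.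
  have [|n1 cond1] := n0_ex eps0; first by rewrite eps0_gt0.
  have [D D0 hD] := tail_convn_mul_le V_supp OSl n1.
  have domn x : tail (randconv V tau) x <= 2 * D * tail (convn V n) x.
    rewrite -mulrA; apply: le_trans (dom eps0 n1 _ cond1 (n1 * l0)%N _ x) _.
    - by rewrite eps0_gt0 lexx.
    - by rewrite leq_pmulr.
    - rewrite ler_pM2l//; apply: le_trans (hD x) _.
      by rewrite ler_pM2l// homo.
  split; last exact: OSn domn.
  apply: (in_L_convn tau_pos _ W_OS n0_ex _ domn liV LW); last exact: mulr_gt0.
  exact: leq_trans l0n.
exists eps0; split; first by rewrite eps0_gt0.
move=> eps n0 /andP[eps_gt0 _] cond; have [n0_gt0 _] := cond.
have dom' : eps <= eps0 -> forall n, (n0 <= n)%N -> forall x,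
    tail (randconv V tau) x <= 2 * tail (convn V n) x.
  by move=> ee0; apply: dom cond; rewrite eps_gt0.
split=> [ee0 n n0n|gamma _ liV LW]; first exact: OSn (dom' ee0 n n0n).
split=> [ee0 n n0n|_ l0 /andP[l0_gt0 _] OSl n|OSV].
- have domn := dom' ee0 n n0n; split; last exact: OSn domn.
  by apply: (in_L_convn tau_pos _ W_OS n0_ex _ domn liV LW) => //; exact: leq_trans n0n.
- exact: main.
- split => //; apply: (@in_L_ext _ (convn V 1) V) => [A|]; first exact: convn1E.
  apply: (main gamma liV LW 1%N _ _ 1%N _).1 => //.
  by apply: OS_ext OSV => A mA; rewrite convn1E.
Qed.
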